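(* Let $X$ be a Banach space. The following assertions are equivalent: (1) $X$ has the Daugavet property. (2) Given a non-empty weakly open set $W$ of $B_X$ it follows that, whenever there exist $x_1,\ldots,x_n\in X$ and positive numbers $r_1,\ldots,r_n$ such that $W\subseteq\bigcup_{i=1}^n B(x_i,r_i)$, then there exists $i\in\{1,\ldots,n\}$ such that $r_i\ge 1+\|x_i\|$. In particular, $W\subseteq B_X\subseteq B(x_i,r_i)$. (3) For every non-empty $b_X$-open subset $O$ of $B_X$ and for every non-empty weakly open subset $W$ of $B_X$ it follows that $W\cap O\neq\emptyset$.
   Context: All Banach spaces are real. $B_X$ is the closed unit ball of $X$, and $B(x,r)=x+rB_X=\{y\in X:\|x-y\|\le r\}$ for $x\in X$ and $r>0$. A Banach space $X$ has the Daugavet property if every bounded rank-one operator $T:X\to X$ satisfies $\|T+I\|=1+\|T\|$, where $I$ is the identity operator. The ball topology $b_X$ is the coarsest topology on $X$ for which every closed ball is closed; a basis of it is formed by the sets $X\setminus\bigcup_{i=1}^n B(x_i,r_i)$ with $x_1,\ldots,x_n\in X$ and $r_1,\ldots,r_n>0$. Weakly open and $b_X$-open subsets of $B_X$ are understood as subsets of $B_X$ that are open in the relative topology induced on $B_X$ by the weak topology and by $b_X$, respectively. *)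

(* Defs.v *)
From HB Require Import structures.
From mathcomp Require Import all_boot all_order all_algebra.
From mathcomp Require Import all_classical all_reals all_analysis.

Set Implicit Arguments.
Unset Strict Implicit.
Unset Printing Implicit Defensive.

Import Order.TTheory GRing.Theory Num.Def Num.Theory.
Import numFieldNormedType.Exports.

Local Open Scope classical_set_scope.
Local Open Scope ring_scope.

(* The closed balls are written with [closed_ball_ normr], i.e.
   [set y | `|x - y| <= r], rather than with the library's [closed_ball],
   which is defined as the closure of the open ball. *)
Definition unit_ball (R : realType) (X : normedModType R) : set X :=
  closed_ball_ normr 0 1.
Arguments unit_ball {R} X.

Definition op_norm (R : realType) (X Y : normedModType R) (T : X -> Y) : R :=
  sup [set `|T x| | x in unit_ball X].

Definition bounded_operator (R : realType) (X Y : normedModType R)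
    (T : X -> Y) : Prop :=
  [bounded T x | x in unit_ball X].

Definition rank_one (R : realType) (X Y : normedModType R) (T : X -> Y) : Prop :=
  exists2 y : Y, y != 0 & range T = [set a *: y | a in [set: R]].

Definition daugavet_property (R : realType) (X : normedModType R) : Prop :=
  forall T : {linear X -> X}, bounded_operator T -> rank_one T ->
    op_norm (fun x => T x + x) = 1 + op_norm T.

Definition dual (R : realType) (X : normedModType R) : Type :=
  {f : {linear X -> R^o} | continuous f}.

(* [weak_topology X] and [ball_topology X] are copies of the type [X], carrying
   the weak topology and the ball topology in place of the norm topology. *)
Definition weak_topology (R : realType) (X : normedModType R) : Type :=
  sup_topology (fun f : dual X =>
    Topological.class (initial_topology (projT1 f : X -> R^o))).

HB.instance Definition _ (R : realType) (X : normedModType R) :=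
  Topological.on (weak_topology X).

Definition ball_topology (R : realType) (X : normedModType R) : Type := X.

Definition ball_subbase (R : realType) (X : normedModType R) : set (set X) :=
  [set ~` closed_ball_ normr p.1 p.2 | p in [set p : X * R | 0 < p.2]].
Arguments ball_subbase {R} X.

HB.instance Definition _ (R : realType) (X : normedModType R) :=
  Choice.on (ball_topology X).
HB.instance Definition _ (R : realType) (X : normedModType R) :=
  isSubBaseTopological.Build (ball_topology X) (ball_subbase X) id.

Definition relatively_open (T : topologicalType) (B W : set T) : Prop :=
  exists2 U : set T, open U & W = U `&` B.

Definition weakly_open_in_ball (R : realType) (X : normedModType R)
    (W : set X) : Prop :=
  @relatively_open (weak_topology X) (unit_ball X) W.

Definition b_open_in_ball (R : realType) (X : normedModType R)
    (O : set X) : Prop :=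
  @relatively_open (ball_topology X) (unit_ball X) O.

(* Main.v *)
(** (1) => (2). Call a subset [C] of the ball norm additive if for all
[x_1, ..., x_n] and [eps > 0] some [y] in [C] satisfies
[(1 - eps) (|x_i| + 1) <= |x_i + y|] for every [i]; a norm additive set cannot be
covered by balls of radius [r_i < 1 + |x_i|]. If [I + f (x) e] almost has norm
[2], being almost attained at [y], and [g] norms [y + f(y) e], then the slice
of [g + g(e) f] near its value at [y] is contained in any prescribed slice of
[f], and [|t e + z|] is almost [t + 1] for all its [z]; iterating over finitely
many [e], slices are norm additive. Norm additivity passes to convex
combinations. Finally a weak neighbourhood contains one of the form
[q (y - x) < e], where [q v] is a finite sum of squares [f(v)^2], and there a
Euclidean argument replaces Bourgain's lemma: the points of the ball that are
[q]-farthest from a remote centre lie in slices of small [q]-diameter, and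
their convex combinations are [q]-dense in the ball.

(2) => (3). If [W] misses a basic [b_X]-open set, it is covered by balls, one of
which then contains the whole ball.

(3) => (1). For [T = f (x) e] with norm [c], intersect the slice where [f(z) |e|]
is almost [c] with the complement of the ball of centre [- (c / |e|) e] and
radius almost [1 + c]. *)

Require Import Defs.
From HB Require Import structures.
From mathcomp Require Import all_boot all_order all_algebra.
From mathcomp Require Import all_classical all_reals all_analysis.
From mathcomp Require Import finmap ring lra.

Set Implicit Arguments.
Unset Strict Implicit.
Unset Printing Implicit Defensive.

Import Order.TTheory GRing.Theory Num.Def Num.Theory.
Import numFieldNormedType.Exports.

Local Open Scope classical_set_scope.
Local Open Scope ring_scope.

(** * Hahn-Banach theorem *)

Record sublinear {R : realType} {V : lmodType R} (p : V -> R) : Prop :=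
  Sublinear {
    sublinearD : forall x y, p (x + y) <= p x + p y;
    sublinearZ : forall a x, 0 < a -> p (a *: x) <= a * p x }.

Section sublinear_theory.
Context {R : realType} {V : lmodType R}.
Implicit Types (p q : V -> R) (x y z : V).

Lemma sublinear0 p : sublinear p -> p 0 = 0.
Proof.
move=> ps; have := sublinearZ ps 0 (ltr0n R 2).
have := @sublinearZ _ _ _ ps 2^-1 0 ltac:(by rewrite invr_gt0).
by rewrite !scaler0; lra.
Qed.

Lemma sublinearN_ge p x : sublinear p -> - p (- x) <= p x.
Proof.
by move=> ps; have := sublinearD ps x (- x); rewrite subrr sublinear0 //; lra.
Qed.

Lemma sublinearMn_ge p x t : sublinear p -> 0 <= t -> t * p x = p (t *: x).
Proof.
move=> ps; rewrite le_eqVlt => /predU1P[<-|t0].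
  by rewrite scale0r mul0r sublinear0.
apply: le_anti; rewrite sublinearZ // andbT -ler_pdivlMl //.
rewrite -{1}[x](scalerK (lt0r_neq0 t0)) sublinearZ ?invr_gt0 //.
Qed.

(** Each member satisfies [- p (- x) <= q x], so the infimum is finite. Directedness yields one
    member below two near-minimisers, whence subadditivity. This bounds chains in Zorn's lemma. *)
Lemma sublinear_inf p (A : set (V -> R)) :
  A !=set0 -> (forall q, A q -> sublinear q /\ forall x, q x <= p x) ->
  (forall q1 q2, A q1 -> A q2 ->
     exists2 q, A q & forall x, q x <= q1 x /\ q x <= q2 x) ->
  let m := fun x => inf [set q x | q in A] in
  sublinear m /\ forall q x, A q -> m x <= q x.
Proof.
move=> [q0 Aq0] Asub Adir m.
have hi x : has_inf [set q x | q in A].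
  split; first by exists (q0 x), q0.
  exists (- p (- x)) => _ [q /Asub[qs qp] <-].
  by rewrite (le_trans _ (sublinearN_ge x qs)) // lerN2.
have mle q x : A q -> m x <= q x by move=> Aq; apply: ge_inf; [exact: (hi x).2|exists q].
have mge c x : (forall q, A q -> c <= q x) -> c <= m x.
  move=> h; apply: lb_le_inf; first by exists (q0 x), q0.
  by move=> _ [q Aq <-]; exact: h.
split=> //; split=> [x y|a x a0].
  apply/ler_addgt0Pr => e e0.
  have e20 : 0 < e / 2 by rewrite divr_gt0.
  have [_ [q1 Aq1 <-] h1] := inf_adherent e20 (hi x).
  have [_ [q2 Aq2 <-] h2] := inf_adherent e20 (hi y).
  have [q Aq qle] := Adir _ _ Aq1 Aq2.
  have := mle _ (x + y) Aq; have := sublinearD (Asub _ Aq).1 x y.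
  by have := (qle x).1; have := (qle y).2; rewrite /m; lra.
rewrite -ler_pdivrMl //; apply: mge => q Aq; rewrite ler_pdivrMl //.
exact: le_trans (mle _ _ Aq) (sublinearZ (Asub _ Aq).1 _ a0).
Qed.

(* The one-sided directional derivative of [p] at [x], as an infimum of
   difference quotients with the increment rescaled to [y]: a sublinear
   minorant of [p] that is linear along [x]. *)
Definition sublinear_along p x y : R :=
  inf [set p (y + t *: x) - t * p x | t in [set t | 0 <= t]].

Lemma sublinear_along_le p x y t : sublinear p -> 0 <= t ->
  sublinear_along p x y <= p (y + t *: x) - t * p x.
Proof.
move=> ps t0; apply: ge_inf; last by exists t.
exists (- p (- y)) => _ [s /= s0 <-].
have := sublinearD ps (y + s *: x) (- y); rewrite addrAC subrr add0r.
by rewrite -sublinearMn_ge //; lra.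
Qed.

Lemma sublinear_along_ge p x y c :
  (forall t, 0 <= t -> c <= p (y + t *: x) - t * p x) ->
  c <= sublinear_along p x y.
Proof.
move=> h; apply: lb_le_inf; first by exists (p (y + 0 *: x) - 0 * p x), 0 => /=.
by move=> _ [t t0 <-]; exact: h.
Qed.

Lemma sublinear_along_le_id p x y : sublinear p -> sublinear_along p x y <= p y.
Proof.
move=> ps; apply: le_trans (sublinear_along_le x y ps (lexx 0)) _.
by rewrite scale0r addr0 mul0r subr0.
Qed.

(** The parameters [t] at [y] and [s] at [z] combine into [t + s] at [y + z]; homogeneity comes from
    rescaling [t] to [a * t]. *)
Lemma sublinear_along_sublinear p x : sublinear p -> sublinear (sublinear_along p x).
Proof.
move=> ps; split=> [y z|a y a0]; last first.
  rewrite -ler_pdivrMl //; apply: sublinear_along_ge => t t0.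
  rewrite ler_pdivrMl //.
  have at0 : 0 <= a * t by rewrite mulr_ge0 // ltW.
  apply: le_trans (sublinear_along_le _ _ ps at0) _.
  by rewrite -scalerA -scalerDr -sublinearMn_ge ?(ltW a0)// mulrBr mulrA.
rewrite -lerBlDr; apply: sublinear_along_ge => t t0.
rewrite lerBlDl -lerBlDr; apply: sublinear_along_ge => s s0.
have := sublinear_along_le x (y + z) ps (addr_ge0 t0 s0).
have := sublinearD ps (y + t *: x) (z + s *: x).
by rewrite scalerDl addrACA; lra.
Qed.

Lemma exists_minimal_sublinear p : sublinear p ->
  exists q, [/\ sublinear q, forall x, q x <= p x &
    forall q', sublinear q' -> (forall x, q' x <= q x) -> q' = q].
Proof.
move=> ps; pose T := {q : V -> R | sublinear q /\ forall x, q x <= p x}.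
(* The order is reversed, so a maximal element is a minimal sublinear minorant. *)
pose le_fun (s t : T) := `[< forall x, sval t x <= sval s x >].
have [| | | |[q [qs qp]] qmin] := @Zorn T le_fun.
- by move=> s; apply/asboolP.
- move=> r s t /asboolP rs /asboolP st; apply/asboolP => x.
  exact: le_trans (st x) (rs x).
- move=> [s Ps] [t Pt] /asboolP /= st /asboolP /= ts; apply: eq_exist.
  by apply/funext => x; apply: le_anti; rewrite st ts.
- move=> A Atot; have [->|/set0P A0] := eqVneq A set0.
    by exists (exist _ p (conj ps (fun x => lexx (p x)))).
  have [|||ms mle] := @sublinear_inf p [set sval t | t in A].
  + by case: A0 => t At; exists (sval t), t.
  + by move=> _ [t _ <-]; exact: (svalP t).
  + move=> _ _ [s As <-] [t At <-].
    have [/asboolP st|/asboolP ts] := Atot _ _ As At.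
      by exists (sval t); [exists t|].
    by exists (sval s); [exists s|].
  have mp x : inf [set q x | q in [set sval t | t in A]] <= p x.
    case: A0 => t At; apply: le_trans (mle (sval t) x _) ((svalP t).2 x).
    by exists t.
  exists (exist (fun q => sublinear q /\ forall x, q x <= p x) _ (conj ms mp)).
  move=> s As; apply/asboolP => x /=.
  by apply: mle; exists s.
- exists q; split=> // q' qs' qq'.
  have qp' x : q' x <= p x := le_trans (qq' x) (qp x).
  by have /(congr1 sval) := qmin (exist _ q' (conj qs' qp')) ltac:(exact/asboolP).
Qed.

(** Minimality forces [sublinear_along q x = q], and the parameter [t = 1] then gives
    superadditivity. *)
Lemma minimal_sublinear_linear q : sublinear q ->
  (forall q', sublinear q' -> (forall x, q' x <= q x) -> q' = q) ->
  linear (q : V -> R^o).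
Proof.
move=> qs qmin.
have qD x y : q (x + y) = q x + q y.
  apply: le_anti; rewrite sublinearD //=.
  have along := qmin _ (sublinear_along_sublinear x qs)
    (fun y => sublinear_along_le_id x y qs).
  have := sublinear_along_le x y qs ler01; rewrite along scale1r mul1r.
  by rewrite [x + y]addrC; lra.
have qN x : q (- x) = - q x.
  by have := qD x (- x); rewrite subrr sublinear0 //; lra.
move=> a x y; rewrite qD; congr (_ + _).
have [a0|a0] := leP 0 a; first by rewrite -sublinearMn_ge.
rewrite -[a]opprK scaleNr qN -sublinearMn_ge ?oppr_ge0 ?ltW //.
by rewrite -mulNr.
Qed.

(** A minimal sublinear function below [sublinear_along p z] is linear; the parameter [t = 1] bounds
    its value at [- z] by [- p z], which forces equality at [z]. *)
Lemma sublinear_ext_linear p z : sublinear p ->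
  exists f : {linear V -> R^o}, (forall x, f x <= p x) /\ f z = p z.
Proof.
move=> ps; have [q [qs qp qmin]] :=
  exists_minimal_sublinear (sublinear_along_sublinear z ps).
have ql := minimal_sublinear_linear qs qmin.
pose f : {linear V -> R^o} := HB.pack (q : V -> R^o)
  (GRing.isLinear.Build R V R^o *:%R q ql).
have fp x : f x <= p x := le_trans (qp x) (sublinear_along_le_id z x ps).
exists f; split=> //; apply: le_anti; rewrite fp /=.
have := sublinear_along_le z (- z) ps ler01; have := qp (- z).
have -> : q (- z) = - q z := linearN f z.
by rewrite scale1r mul1r addNr sublinear0 //; lra.
Qed.

End sublinear_theory.

Lemma normr_sublinear (R : realType) (X : normedModType R) :
  sublinear (fun x : X => `|x|).
Proof. by split=> [x y|a x a0]; rewrite ?ler_normD// normrZ gtr0_norm. Qed.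

Lemma norming_functional {R : realType} {X : normedModType R} (z : X) :
  exists f : {linear X -> R^o}, (forall x, `|f x| <= `|x|) /\ f z = `|z|.
Proof.
have [f [fle fz]] := sublinear_ext_linear z (normr_sublinear X).
exists f; split=> // x; rewrite ler_norml fle andbT lerNl -linearN.
by rewrite (le_trans (fle _)) ?normrN.
Qed.

(** * Slices in a space with the Daugavet property *)

Lemma unit_ballE {R : realType} {X : normedModType R} (y : X) :
  unit_ball X y = (`|y| <= 1) :> Prop.
Proof. by rewrite /unit_ball /closed_ball_ /= sub0r normrN. Qed.

Section op_norm_theory.
Context {R : realType} {X Y : normedModType R}.
Implicit Type T : X -> Y.

Lemma bounded_operator_has_sup T :
  bounded_operator T -> has_sup [set `|T x| | x in unit_ball X].
Proof.
move=> [M [_ TM]]; split; first by exists `|T 0|, 0 => //; rewrite unit_ballE normr0.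
by exists (M + 1) => _ [x xB <-]; apply: TM => //; rewrite ltrDl.
Qed.

Lemma op_norm_ge T x : bounded_operator T -> `|x| <= 1 -> `|T x| <= op_norm T.
Proof.
move=> Tb x1; apply: ub_le_sup; first exact: (bounded_operator_has_sup Tb).2.
by exists x => //; rewrite unit_ballE.
Qed.

Lemma op_norm_le T c : (forall x, `|x| <= 1 -> `|T x| <= c) -> op_norm T <= c.
Proof.
move=> Tc; apply: ge_sup.
  by exists `|T 0|, 0 => //; rewrite unit_ballE normr0.
by move=> _ [x + <-]; rewrite unit_ballE; exact: Tc.
Qed.

Lemma op_norm_adherent T e : bounded_operator T -> 0 < e ->
  exists2 x, `|x| <= 1 & op_norm T - e < `|T x|.
Proof.
move=> /bounded_operator_has_sup Ts e0.
have [_ [x + <-] Tx] := sup_adherent e0 Ts.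
by rewrite unit_ballE => x1; exists x.
Qed.

Lemma bounded_operatorP T c :
  (forall x, `|x| <= 1 -> `|T x| <= c) -> bounded_operator T.
Proof.
move=> Tc; exists c; rewrite num_real; split => // M cM x /=.
by rewrite unit_ballE => /Tc /le_trans; apply; exact: ltW.
Qed.

End op_norm_theory.

Lemma linear_op_norm_le {R : realType} {X Y : normedModType R}
    (T : {linear X -> Y}) (x : X) :
  bounded_operator T -> `|T x| <= op_norm T * `|x|.
Proof.
move=> Tb; have [->|x0] := eqVneq x 0; first by rewrite linear0 !normr0 mulr0.
have nx : 0 < `|x| by rewrite normr_gt0.
have := @op_norm_ge _ _ _ T (`|x|^-1 *: x) Tb.
rewrite linearZ !normrZ normfV normr_id mulVf ?gt_eqF // => /(_ (lexx 1)).
by rewrite ler_pdivrMl // mulrC.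
Qed.

Definition rank_one_op {R : realType} {X : normedModType R}
  (f : {linear X -> R^o}) (e z : X) : X := (f z : R) *: e.

Section rank_one_op.
Context {R : realType} {X : normedModType R} (f : {linear X -> R^o}) (e : X).

Lemma rank_one_op_linear : linear (rank_one_op f e).
Proof. by move=> a x y; rewrite /rank_one_op linearP /= scalerDl scalerA. Qed.

HB.instance Definition _ :=
  GRing.isLinear.Build R X X *:%R (rank_one_op f e) rank_one_op_linear.

Lemma rank_one_op_rank_one z : e != 0 -> (f z : R) != 0 -> rank_one (rank_one_op f e).
Proof.
move=> e0 fz; exists e => //; apply/seteqP; split=> [_ [x _ <-]|_ [a _ <-]].
  by exists (f x).
exists ((a / f z) *: z) => //.
by rewrite /rank_one_op linearZ; congr (_ *: _); exact: divfK.
Qed.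

End rank_one_op.

Lemma daugavet_almost_norming {R : realType} {X : normedModType R}
    (f : {linear X -> R^o}) (e : X) (eps : R) :
  daugavet_property X -> bounded_operator f -> op_norm f = 1 ->
  `|e| = 1 -> 0 < eps ->
  exists y : X, [/\ `|y| <= 1, 0 <= (f y : R) & 2 - eps < `|(f y : R) *: e + y|].
Proof.
move=> dX fb f1 e1 eps0.
have normT z : `|rank_one_op f e z| = `|f z| by rewrite normrZ e1 mulr1.
have Tb : bounded_operator (rank_one_op f e).
  by apply: (@bounded_operatorP _ _ _ _ 1) => x x1; rewrite normT -f1 op_norm_ge.
have e0 : e != 0 by rewrite -normr_gt0 e1.
have [z _ fz] := op_norm_adherent fb ltr01.
have fz0 : (f z : R) != 0 by rewrite -normr_gt0 (le_lt_trans _ fz) // f1 subrr.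
have := dX _ Tb (rank_one_op_rank_one e0 fz0).
have -> : op_norm (rank_one_op f e) = 1.
  rewrite -f1; apply: le_anti; rewrite !op_norm_le // => x x1.
    by rewrite -normT op_norm_ge.
  by rewrite normT op_norm_ge.
move=> dT; have [h|] := pselect (forall y, `|y| <= 1 -> `|rank_one_op f e y + y| <= 2 - eps).
  have := op_norm_le h; rewrite dT; lra.
move/existsNP => [y /not_implyP[y1 /negP]]; rewrite -ltNge => hy.
(* Passing to [- y] keeps the norm and makes the value of [f] nonnegative. *)
have [fy|fy] := leP 0 (f y : R); first by exists y.
exists (- y); rewrite normrN linearN oppr_ge0 (ltW fy); split=> //.
by rewrite scaleNr -opprD normrN.
Qed.

Definition slice {R : realType} {X : normedModType R} (f : X -> R) (a : R) : set X :=
  [set y | `|y| <= 1 /\ a < f y].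

Lemma slice_shrink_pos {R : realType} {X : normedModType R}
    (f : {linear X -> R^o}) (a : R) (e : X) (eps : R) :
  daugavet_property X -> bounded_operator f -> 0 < op_norm f ->
  slice f a !=set0 -> `|e| = 1 -> 0 < eps ->
  exists (g : {linear X -> R^o}) b, [/\ bounded_operator g, slice g b !=set0,
    slice g b `<=` slice f a &
    forall y t, slice g b y -> 0 <= t -> (1 - eps) * (t + 1) <= `|t *: e + y|].
Proof.
move=> dX fb f0 [y1 [y11 afy1]] e1 eps0.
have aF : a < op_norm f.
  by apply: lt_le_trans afy1 _; apply: le_trans (op_norm_ge fb y11); exact: ler_norm.
pose h : {linear X -> R^o} := (op_norm f)^-1 \*: f.
have hb1 x : `|h x| <= `|x|.
  rewrite normrM normfV (gtr0_norm f0) ler_pdivrMl //.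
  exact: linear_op_norm_le.
have hb : bounded_operator h.
  by apply: (@bounded_operatorP _ _ _ _ 1) => x; exact: le_trans.
have h1 : op_norm h = 1.
  apply: le_anti; apply/andP; split.
    by apply: op_norm_le => x; exact: le_trans.
  apply/ler_addgt0Pr => d d0; have [x x1 fx] := op_norm_adherent fb (mulr_gt0 f0 d0).
  rewrite -lerBlDr; apply: le_trans (op_norm_ge hb x1).
  rewrite normrM normfV (gtr0_norm f0) ler_pdivlMl // mulrBr mulr1; exact: ltW.
(* The three bounds serve in turn the norm estimate, the inclusion in the slice of [f], and the
   positivity of [1 - d], hence of [g e]. *)
pose d := Num.min (Num.min eps (1 - a / op_norm f)) (2^-1).
have d0 : 0 < d.
  by rewrite !lt_min eps0 subr_gt0 ltr_pdivrMr // mul1r aF invr_gt0 ltr0n.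
have deps : d <= eps by rewrite !ge_min lexx.
have da : d <= 1 - a / op_norm f by rewrite !ge_min lexx !orbT.
have d2 : d <= 2^-1 by rewrite !ge_min lexx !orbT.
have {}da : a <= op_norm f * (1 - d).
  by rewrite -ler_pdivrMl // mulrC; lra.
have [y0 [y01 hy0_ge0 hy0]] := daugavet_almost_norming dX hb h1 e1 d0.
have [g [gb1 gy0]] := norming_functional ((h y0 : R) *: e + y0).
have {gy0}hy0 : 2 - d < h y0 * g e + g y0 by rewrite -gy0 linearD linearZ in hy0.
have ge1 : g e <= 1 by rewrite -e1 (le_trans (ler_norm _)).
have hle1 (y : X) : `|y| <= 1 -> h y <= 1.
  by move=> y1'; rewrite (le_trans (ler_norm _)) // (le_trans (hb1 y)).
have gle1 (y : X) : `|y| <= 1 -> g y <= 1.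
  by move=> y1'; rewrite (le_trans (ler_norm _)) // (le_trans (gb1 y)).
(* If two terms at most [1] have sum above [2 - d], each exceeds [1 - d]. On the slice of [k] the
   same argument bounds [h y] and [g y] from below. *)
have ge0 : 1 - d <= g e by have := gle1 _ y01; have := hle1 _ y01; nra.
pose k : {linear X -> R^o} := g \+ ((g e : R) \*: h).
exists k, (2 - d); split.
- apply: (@bounded_operatorP _ _ _ _ (1 + `|g e|)) => x x1 /=.
  rewrite (le_trans (ler_normD _ _)) // lerD ?(le_trans (gb1 x)) //.
  by rewrite normrM ler_piMr // (le_trans (hb1 x)).
- have ky0 : 2 - d < g y0 + g e * h y0 by lra.
  by exists y0.
- move=> y [y1' ky]; split=> //; apply: le_lt_trans da _.
  have : 1 - d < h y.
    have {}ky : 2 - d < g y + g e * h y by [].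
    by have := gle1 _ y1'; nra.
  by rewrite -ltr_pdivlMl.
- move=> y t [y1' ky] t0.
  have {}ky : 2 - d < g y + g e * h y by [].
  have gy : 1 - d <= g y by have := hle1 _ y1'; nra.
  apply: le_trans (gb1 _); apply: le_trans (ler_norm _).
  have -> : g (t *: e + y) = t * g e + g y by rewrite linearD linearZ.
  have : t * (1 - eps) <= t * g e by rewrite ler_wpM2l //; lra.
  by lra.
Qed.

Lemma slice_shrink {R : realType} {X : normedModType R}
    (f : {linear X -> R^o}) (a : R) (x : X) (eps : R) :
  daugavet_property X -> (exists x : X, x != 0) -> bounded_operator f ->
  slice f a !=set0 -> 0 < eps ->
  exists (g : {linear X -> R^o}) b, [/\ bounded_operator g, slice g b !=set0,
    slice g b `<=` slice f a &
    forall y, slice g b y -> (1 - eps) * (`|x| + 1) <= `|x + y|].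
Proof.
move=> dX [z z0] fb fa eps0.
have normed (u : X) : u != 0 -> `| `|u|^-1 *: u| = 1.
  by move=> u0; rewrite normrZ normfV normr_id mulVf // normr_eq0.
(* For [x = 0] any unit direction serves, since then [t = 0]. *)
have [e [e1 xe]] : exists e : X, `|e| = 1 /\ x = `|x| *: e.
  have [->|x0] := eqVneq x 0.
    by exists (`|z|^-1 *: z); rewrite normed // normr0 scale0r.
  by exists (`|x|^-1 *: x); rewrite normed // scalerKV // normr_eq0.
suff [g [b [gb gne gsub gnorm]]] : exists (g : {linear X -> R^o}) b,
    [/\ bounded_operator g, slice g b !=set0, slice g b `<=` slice f a &
    forall y t, slice g b y -> 0 <= t -> (1 - eps) * (t + 1) <= `|t *: e + y|].
  exists g, b; split=> // y gy; rewrite {2}xe; exact: gnorm.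
have fge0 : 0 <= op_norm f.
  by rewrite (le_trans _ (op_norm_ge fb (_ : `|0| <= 1))) // normr0.
have [f0|f0] := ltP 0 (op_norm f); first exact: slice_shrink_pos.
(* Here [f = 0] and the slice is the whole ball, which contains a slice given
   by a nonzero functional. *)
have [g [g1 gz]] := norming_functional z.
have gb : bounded_operator g.
  by apply: (@bounded_operatorP _ _ _ _ 1) => u; exact: le_trans.
have gz1 : g (`|z|^-1 *: z) = 1.
  by rewrite linearZ /= gz; apply: mulVf; rewrite normr_eq0.
have gpos : 0 < op_norm g.
  have := op_norm_ge gb (_ : `| `|z|^-1 *: z| <= 1).
  by rewrite normed // gz1 normr1 => /(_ (lexx 1)); exact: lt_le_trans.
have gne : slice g 0 !=set0.
  by exists (`|z|^-1 *: z); rewrite /slice /= normed // gz1.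
have [k [b [kb kne ksub knorm]]] := slice_shrink_pos dX gb gpos gne e1 eps0.
exists k, b; split=> // y /ksub[y1 _]; split=> //.
have f00 u : f u = 0.
  apply/eqP; rewrite -normr_le0 (le_trans (linear_op_norm_le u fb)) //.
  by rewrite mulr_le0_ge0.
by case: fa => u [_]; rewrite !f00.
Qed.

(* Over the unit ball [|x + y|] never exceeds [|x| + 1]: a single point of [C]
   almost attains this bound for finitely many [x] at once. *)
Definition norm_additive {R : realType} {X : normedModType R} (C : set X) : Prop :=
  forall (s : seq X) (eps : R), 0 < eps ->
    exists2 y, C y & forall x, x \in s -> (1 - eps) * (`|x| + 1) <= `|x + y|.

(** The slice is shrunk once for each vector of the list; the slices are nested, so earlier
    estimates persist. *)
Lemma norm_additive_slice {R : realType} {X : normedModType R}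
    (f : {linear X -> R^o}) (a : R) :
  daugavet_property X -> (exists x : X, x != 0) -> bounded_operator f ->
  slice f a !=set0 -> norm_additive (slice f a).
Proof.
move=> dX X0 fb fa s eps eps0.
suff [g [b [_ [y gy] sub h]]] : exists (g : {linear X -> R^o}) b,
    [/\ bounded_operator g, slice g b !=set0, slice g b `<=` slice f a &
    forall y x, slice g b y -> x \in s -> (1 - eps) * (`|x| + 1) <= `|x + y|].
  by exists y; [exact: sub|move=> x; exact: h].
elim: s => [|x s [g [b [gb gne gsub gs]]]]; first by exists f, a; split.
have [k [c [kb kne ksub kx]]] := slice_shrink x dX X0 gb gne eps0.
exists k, c; split=> //; first exact: subset_trans gsub.
move=> y u ky; rewrite inE => /predU1P[->|us]; first exact: kx.
by apply: gs => //; exact: ksub.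
Qed.

Lemma norm_additiveS {R : realType} {X : normedModType R} (C D : set X) :
  C `<=` D -> norm_additive C -> norm_additive D.
Proof.
move=> CD Cn s eps eps0; have [y Cy h] := Cn s eps eps0.
by exists y => //; exact: CD.
Qed.

(** The point [y] is chosen first, for the vectors [t^-1 *: x]; then [z] is chosen for the rescaled
    vectors [x + t *: y], which already contain [y]. *)
Lemma norm_additive_conv {R : realType} {X : normedModType R} (C D : set X)
    (t : R) : 0 < t < 1 -> norm_additive C -> norm_additive D ->
  norm_additive [set t *: p.1 + (1 - t) *: p.2 | p in C `*` D].
Proof.
move=> /andP[t0 t1] Cn Dn s eps eps0.
(* For [eps >= 1] the lower bound is nonpositive and any point will do. *)
have [eps1|eps1] := leP 1 eps.
  have [y Cy _] := Cn s eps eps0; have [z Dz _] := Dn s eps eps0.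
  exists (t *: y + (1 - t) *: z); first by exists (y, z).
  move=> x _; apply: le_trans (normr_ge0 _).
  by rewrite mulr_le0_ge0 ?addr_ge0 // subr_le0.
have e20 : 0 < eps / 2 by rewrite divr_gt0.
have u0 : 0 < 1 - t by lra.
have [y Cy hy] := Cn [seq t^-1 *: x | x <- s] _ e20.
have [z Dz hz] := Dn [seq (1 - t)^-1 *: (x + t *: y) | x <- s] _ e20.
exists (t *: y + (1 - t) *: z); first by exists (y, z).
have scale_est (c : R) (x v : X) : 0 < c ->
    (1 - eps / 2) * (`|c^-1 *: x| + 1) <= `|c^-1 *: x + v| ->
    (1 - eps / 2) * (`|x| + c) <= `|x + c *: v|.
  move=> c0; have nZ (w : X) : c * `|w| = `|c *: w| by rewrite normrZ gtr0_norm.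
  rewrite -(ler_pM2l c0) mulrCA mulrDr mulr1 !nZ scalerDr scalerKV //.
  by rewrite gt_eqF.
move=> x xs.
have {hy}hy := scale_est t x y t0 (hy _ (map_f _ xs)).
have {hz}hz := scale_est (1 - t) _ z u0 (hz _ (map_f (fun x => _) xs)).
rewrite addrA; apply: le_trans hz.
(* The two losses combine through [(1 - eps / 2) ^+ 2 >= 1 - eps]. *)
have := normr_ge0 x; nra.
Qed.

(** * Weak neighbourhoods in a space with the Daugavet property *)

Record semi_inner {R : realType} {X : normedModType R} (b : X -> X -> R) : Prop :=
  SemiInner {
    semi_innerC : forall u v, b u v = b v u;
    semi_innerP : forall u a v w, b u (a *: v + w) = a * b u v + b u w;
    semi_inner_ge0 : forall u, 0 <= b u u;
    semi_inner_bounded :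
      exists2 M, 0 <= M & forall u v, `|b u v| <= M * (`|u| * `|v|) }.

Section semi_inner_theory.
Context {R : realType} {X : normedModType R} (b : X -> X -> R).
Hypothesis bP : semi_inner b.
Implicit Types (u v w x y z : X).

Let q v := b v v.

Let bDr u v w : b u (v + w) = b u v + b u w.
Proof. by rewrite -[v]scale1r semi_innerP // mul1r scale1r. Qed.

Let b0r u : b u 0 = 0.
Proof. by have := bDr u 0 0; rewrite addr0; lra. Qed.

Let bZr u a v : b u (a *: v) = a * b u v.
Proof. by rewrite -[_ *: _]addr0 semi_innerP // b0r addr0. Qed.

Let bNr u v : b u (- v) = - b u v.
Proof. by rewrite -scaleN1r bZr mulN1r. Qed.

Let bDl u v w : b (v + w) u = b v u + b w u.
Proof. by rewrite !(semi_innerC bP _ u) bDr. Qed.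

Let bZl u a v : b (a *: v) u = a * b v u.
Proof. by rewrite !(semi_innerC bP _ u) bZr. Qed.

Let bNl u v : b (- v) u = - b v u.
Proof. by rewrite !(semi_innerC bP _ u) bNr. Qed.

Let bE := (bDr, bDl, bZr, bZl, bNr, bNl).

Let qN v : q (- v) = q v.
Proof. by rewrite /q !bE opprK. Qed.

Let q_conv (t : R) v w : 0 <= t <= 1 ->
  q (t *: v + (1 - t) *: w) <= t * q v + (1 - t) * q w.
Proof.
move=> /andP[t0 t1]; have := semi_inner_ge0 bP (v - w).
rewrite /q !bE (semi_innerC bP w v) => h.
have : 0 <= t * (1 - t) by rewrite mulr_ge0 // subr_ge0.
nra.
Qed.

Let q_add_le v w : q (v + w) <= 2 * q v + 2 * q w.
Proof.
have := semi_inner_ge0 bP (v - w).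
by rewrite /q !bE (semi_innerC bP w v); lra.
Qed.

(** Centres of norm additive [q]-balls within the unit ball. They form a convex set, shown below to
    be [q]-dense in the unit ball. *)
Definition norm_additive_points (c : R) : set X :=
  [set z | `|z| <= 1 /\ norm_additive [set y | `|y| <= 1 /\ q (y - z) < c]].

Lemma norm_additive_points_conv c t y z : 0 < t < 1 ->
  norm_additive_points c y -> norm_additive_points c z ->
  norm_additive_points c (t *: y + (1 - t) *: z).
Proof.
move=> t01 [y1 yc] [z1 zc]; have /andP[t0 t1] := t01.
have conv_ball (v w : X) : `|v| <= 1 -> `|w| <= 1 -> `|t *: v + (1 - t) *: w| <= 1.
  move=> v1 w1; rewrite (le_trans (ler_normD _ _)) // !normrZ !gtr0_norm ?subr_gt0 //.
  have : t * `|v| <= t * 1 by rewrite ler_pM2l.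
  have : (1 - t) * `|w| <= (1 - t) * 1 by rewrite ler_pM2l // subr_gt0.
  by lra.
split; first exact: conv_ball.
apply: norm_additiveS (norm_additive_conv t01 yc zc).
move=> _ [[v w] [/= [v1 vy] [w1 wz]] <-]; split; first exact: conv_ball.
have -> : t *: v + (1 - t) *: w - (t *: y + (1 - t) *: z) =
    t *: (v - y) + (1 - t) *: (w - z).
  by rewrite opprD addrACA !scalerBr.
apply: le_lt_trans (q_conv _ _ _) _; first by rewrite (ltW t0) (ltW t1).
by nra.
Qed.

Hypotheses (dX : daugavet_property X) (X0 : exists x : X, x != 0).

(* A point of the ball that is almost [b]-farthest from [- t u] is strongly
   exposed by [b (y + t u)]; for large [t] it almost maximises [b u]. *)
Lemma norm_additive_point_maximal (c : R) u x (eta : R) : 0 < c -> 0 < eta -> `|x| <= 1 ->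
  exists2 y, norm_additive_points c y & b u x - eta <= b u y.
Proof.
move=> c0 eta0 x1; have [M M0 bM] := semi_inner_bounded bP.
have qM v : `|v| <= 1 -> q v <= M.
  move=> v1; apply: le_trans (ler_norm _) _; apply: le_trans (bM _ _) _.
  by rewrite ler_piMr // mulr_ile1.
have buM v : `|v| <= 1 -> b u v <= M * `|u|.
  move=> v1; apply: le_trans (ler_norm _) _; apply: le_trans (bM _ _) _.
  by rewrite ler_wpM2l // ler_piMr.
(* Comparing [phi x] with [phi y] costs at most [c / 2 + M]; dividing by [2 * t] turns this into
   [eta]. *)
have [t t0 teta] : exists2 t : R, 0 < t & 2 * t * eta = c / 2 + M.
  exists ((c / 2 + M) / (2 * eta)); last by field; rewrite gt_eqF.
  by rewrite divr_gt0 ?mulr_gt0 // ltr_wpDr // divr_gt0.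
(* Up to a constant this is [q (v + t *: u)], the squared distance from [- t *: u]. *)
pose phi v := q v + 2 * t * b u v.
have hs : has_sup [set phi v | v in [set v | `|v| <= 1]].
  split; first by exists (phi x), x.
  exists (M + 2 * t * (M * `|u|)) => _ [v /= v1 <-].
  by rewrite lerD ?qM // ler_wpM2l ?buM // mulr_ge0 // ltW.
have c20 : 0 < c / 2 by rewrite divr_gt0.
have [_ [y /= y1 <-]] := sup_adherent c20 hs.
set s := sup _ => sy.
have phis v : `|v| <= 1 -> phi v <= s by move=> v1; apply: ub_le_sup; [exact: hs.2|exists v].
exists y; last first.
  have := phis _ x1; have := qM _ y1; have := semi_inner_ge0 bP x.
  rewrite -/(q x) => qx qy px.
  have : 2 * t * (b u x - eta - b u y) <= 0.
    by move: sy px qx qy teta; rewrite /phi; lra.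
  by rewrite pmulr_rle0 ?mulr_gt0 //; lra.
split=> //.
pose f : {linear X -> R^o} := HB.pack (b (y + t *: u) : X -> R^o)
  (GRing.isLinear.Build R X R^o *:%R (b (y + t *: u)) (semi_innerP bP (y + t *: u))).
have fb : bounded_operator f.
  apply: (@bounded_operatorP _ _ _ _ (M * `|y + t *: u|)) => v v1.
  by apply: le_trans (bM _ _) _; rewrite ler_wpM2l // ler_piMr.
have fE v : f v = b y v + t * b u v by rewrite -bZl -bDl.
(* The threshold comes from [q (v - y) = phi v + phi y - 2 * (f v + t * b u y)]: both values of
   [phi] are at most [s], so the slice lies where [q (v - y) < c]. *)
apply: norm_additiveS (norm_additive_slice dX X0 fb (a := s - c / 2 - t * b u y) _).
  move=> v [v1]; rewrite fE => fv; split=> //.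
  have := phis _ v1; rewrite /phi /q !bE (semi_innerC bP v y).
  by have := phis _ y1; rewrite /phi /q; lra.
by exists y; split=> //; rewrite fE; move: sy; rewrite /phi /q; lra.
Qed.

(** A projection argument: were the infimum [d] of [q (x - z)] positive, moving a near-minimiser [z]
    slightly towards a point that almost maximises [b (x - z)] would bring it below [d], against
    convexity. *)
Lemma norm_additive_point_dense (c : R) x (e : R) : 0 < c -> 0 < e -> `|x| <= 1 ->
  exists2 z, norm_additive_points c z & q (x - z) < e.
Proof.
move=> c0 e0 x1; have [M M0 bM] := semi_inner_bounded bP.
pose D := [set q (x - z) | z in norm_additive_points c].
have hD : has_inf D.
  split; last by exists 0 => _ [z _ <-]; exact: (semi_inner_ge0 bP).
  have [z zc _] := norm_additive_point_maximal 0 c0 ltr01 x1.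
  by exists (q (x - z)), z.
have [d0|d0] := leP (inf D) 0.
  have [_ [z zc <-] ze] := inf_adherent e0 hD.
  by exists z => //; apply: lt_le_trans ze _; lra.
exfalso; move: d0; set d := inf D => d0.
have dle z : norm_additive_points c z -> d <= q (x - z).
  by move=> zc; apply: ge_inf; [exact: hD.2|exists z].
(* The step is small enough for [l * q (y - z) <= d / 2]; the added [1] keeps the denominator
   positive when [M = 0]. *)
pose l := Num.min 8^-1 (d / (8 * M + 1)).
have M1 : 0 < 8 * M + 1 by lra.
have l0 : 0 < l by rewrite lt_min invr_gt0 ltr0n divr_gt0.
have l2 : l <= 8^-1 by rewrite ge_min lexx.
have lM : l * (4 * M) <= d / 2.
  have : l * (8 * M + 1) <= d by rewrite -ler_pdivlMr // ge_min lexx orbT.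
  by lra.
have ld0 : 0 < l * d by rewrite mulr_gt0.
have [_ [z zc <-] zd] := inf_adherent ld0 hD; rewrite -/d in zd.
have [y yc ybig] := norm_additive_point_maximal (x - z) c0 ld0 x1.
have l1 : 0 < l < 1 by rewrite l0 (le_lt_trans l2) // invf_lt1 // ltr1n.
have := dle _ (norm_additive_points_conv l1 yc zc).
have qyz : q (y - z) <= 4 * M.
  apply: le_trans (ler_norm _) _; apply: le_trans (bM _ _) _.
  have yz : `|y - z| <= 2.
    by rewrite (le_trans (ler_normB _ _)) // -[2]/(1 + 1) lerD // ?yc.1 ?zc.1.
  rewrite mulrC ler_wpM2r //; have := normr_ge0 (y - z); nra.
have -> : x - (l *: y + (1 - l) *: z) = (x - z) - l *: (y - z).
  by rewrite scalerBl scale1r scalerBr !opprD !opprK !addrA (addrAC x (- z)).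
have {}ybig : q (x - z) - l * d <= b (x - z) (y - z).
  by move: ybig; rewrite /q !bDr !bNr; lra.
move: (dle _ zc) zd qyz ybig; rewrite /q.
move: (x - z) (y - z) => u v; rewrite !bE (semi_innerC bP v u).
move=> zd' zd qyz ybig.
(* In [q (u - l *: v) = q u - 2 * l * b u v + l ^+ 2 * q v] the linear term gains about [2 * l * d],
   which outweighs the slack [l * d] of [z], the quadratic term [l * d / 2] and the errors of order
   [l ^+ 2 * d]. *)
have h1 : l * (b u u - l * d) <= l * b u v by rewrite ler_wpM2l ?(ltW l0) //; lra.
have h2 : l * (l * b v v) <= l * (d / 2).
  by rewrite ler_wpM2l ?(ltW l0) // (le_trans _ lM) // ler_wpM2l // ltW.
have h3 : l * d <= l * b u u by rewrite ler_wpM2l // ltW.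
have h4 : l * (l * d) <= 8^-1 * (l * d) by rewrite ler_wpM2r // ltW.
lra.
Qed.

Lemma norm_additive_semi_inner_nbhs x e : 0 < e -> `|x| <= 1 ->
  norm_additive [set y | `|y| <= 1 /\ q (y - x) < e].
Proof.
move=> e0 x1; have e4 : 0 < e / 4 by rewrite divr_gt0.
have [z [z1 zn] zx] := norm_additive_point_dense e4 e4 x1.
apply: norm_additiveS zn => y [y1 yz]; split=> //.
have := q_add_le (y - z) (z - x); rewrite addrA subrK -(qN (z - x)) opprB.
by lra.
Qed.

End semi_inner_theory.

(** * Weak and ball topologies *)

Definition dual_form {R : realType} {X : normedModType R} (s : seq (dual X))
  (u v : X) : R := \sum_(f <- s) (projT1 f u : R) * projT1 f v.

Lemma dual_bounded {R : realType} {X : normedModType R} (f : dual X) :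
  exists2 M, 0 <= M & forall x, `|projT1 f x| <= M * `|x|.
Proof.
case: f => f /= /linear_bounded_continuous /linear_boundedP [M [_ fM]].
exists (`|M| + 1) => [|x]; first by rewrite addr_ge0.
by apply: fM; rewrite (le_lt_trans (ler_norm M)) // ltrDl.
Qed.

Lemma dual_form_semi_inner {R : realType} {X : normedModType R} (s : seq (dual X)) :
  semi_inner (dual_form s).
Proof.
split=> [u v|u a v w|u|].
- by apply: eq_bigr => f _; rewrite mulrC.
- rewrite /dual_form mulr_sumr -big_split; apply: eq_bigr => f _ /=.
  by rewrite linearP mulrDr; congr (_ + _); exact: mulrCA.
- by apply: sumr_ge0 => f _; rewrite -expr2 sqr_ge0.
- elim: s => [|f s [M M0 IH]].
    by exists 0 => // u v; rewrite /dual_form big_nil normr0 mul0r.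
  have [N N0 fN] := dual_bounded f.
  exists (N * N + M) => [|u v]; first by rewrite addr_ge0 ?mulr_ge0.
  rewrite /dual_form big_cons mulrDl (le_trans (ler_normD _ _)) // lerD //; last exact: IH.
  by rewrite mulrACA normrM ler_pM.
Qed.

(** The sets [dual_form s (y - x) (y - x) < e] generate a filter at [x], concatenation of lists
    giving intersections. As the weak topology is a supremum, its convergence to [x] is checked on
    one functional at a time. *)
Lemma weakly_open_in_ball_nbhs {R : realType} {X : normedModType R}
    (W : set X) (x : X) :
  weakly_open_in_ball W -> W x ->
  exists (s : seq (dual X)) (e : R), 0 < e /\
    [set y | `|y| <= 1 /\ dual_form s (y - x) (y - x) < e] `<=` W.
Proof.
move=> [U Uo ->] [Ux _].
pose F : set_system (weak_topology X) := [set A | exists (s : seq (dual X)) (e : R),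
  0 < e /\ [set y | dual_form s (y - x) (y - x) < e] `<=` A].
suff [s [e [e0 sU]]] : F U.
  by exists s, e; split=> // y [y1 yx]; split; [exact: sU|rewrite unit_ballE].
have catE (s t : seq (dual X)) u :
    dual_form (s ++ t) u u = dual_form s u u + dual_form t u u.
  by rewrite /dual_form big_cat.
have FF : Filter F.
  split.
  - by exists [::], 1; split.
  - move=> A B [s [e [e0 sA]]] [t [d [d0 tB]]].
    exists (s ++ t), (Num.min e d); split; first by rewrite lt_min e0.
    move=> y /=; rewrite catE => /lt_le_trans h; split.
      apply: sA => /=; apply: le_lt_trans (h e _); last by rewrite ge_min lexx.
      by rewrite lerDl (semi_inner_ge0 (dual_form_semi_inner t)).
    apply: tB => /=; apply: le_lt_trans (h d _); last by rewrite ge_min lexx orbT.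
    by rewrite lerDr (semi_inner_ge0 (dual_form_semi_inner s)).
  - by move=> A B AB [s [e [e0 sA]]]; exists s, e; split=> //; exact: subset_trans AB.
suff Fx : F --> (x : weak_topology X) by apply: Fx; exact: open_nbhs_nbhs.
apply/cvg_sup => f A [_ [[B Bo <-] /= Bfx BA]].
have : nbhs (projT1 f x) B by exact: open_nbhs_nbhs.
rewrite -nbhs_ballE => -[d /= d0 dB].
exists [:: f], (d ^+ 2); split=> [|y]; first exact: exprn_gt0.
rewrite /= /dual_form big_seq1 -expr2 => yd; apply: BA; apply: dB.
rewrite -ball_normE /= distrC -linearB -(ltr_pXn2r (n := 2)) ?nnegrE ?(ltW d0) //.
by rewrite real_normK ?num_real.
Qed.

Lemma weakly_open_slice {R : realType} {X : normedModType R}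
    (f : {linear X -> R^o}) (a : R) :
  continuous f -> weakly_open_in_ball (slice f a).
Proof.
move=> fc; exists [set y | a < f y]; last first.
  by apply/seteqP; split=> y; rewrite /slice /= unit_ballE => -[].
pose g : dual X := exist _ f fc.
have gc : continuous (f : weak_topology X -> R^o).
  move=> y A /= fA.
  have /cvg_sup := @cvg_refl _ (nbhs (y : weak_topology X)).
  move=> /(_ g); apply; exact: initial_continuous fA.
apply: (open_comp (f := (f : weak_topology X -> R^o)) (D := [set r | a < r])).
  by move=> y _; exact: gc.
exact: open_gt.
Qed.

Lemma b_open_in_ball_nbhs {R : realType} {X : normedModType R} (O : set X) (z : X) :
  b_open_in_ball O -> O z ->
  exists (n : nat) (x : 'I_n -> X) (r : 'I_n -> R),
    [/\ forall i, 0 < r i, forall i, ~ closed_ball_ normr (x i) (r i) z &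
      [set y | `|y| <= 1 /\ forall i, ~ closed_ball_ normr (x i) (r i) y] `<=` O].
Proof.
move=> [U [V Vbase <-] ->] [[B VB Bz] _].
have [F Fsub FB] := Vbase _ VB.
(* Centre and radius are chosen for each member of [F]; the pair [(0, 0)] is a default outside
   [F]. *)
have center (E : set X) : {p : X * R | E \in F -> 0 < p.2 /\ E = ~` closed_ball_ normr p.1 p.2}.
  apply: cid; have [EF|_] := boolP (E \in F); last by exists (0, 0).
  by have /set_mem [p p0 <-] := Fsub _ EF; exists p.
pose c (i : 'I_(size F)) := sval (center (nth set0 F i)).
have cP i : 0 < (c i).2 /\ nth set0 F i = ~` closed_ball_ normr (c i).1 (c i).2.
  by apply: (svalP (center (nth set0 F i))); exact: mem_nth.
exists (size F), (fun i => (c i).1), (fun i => (c i).2).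
split=> [i|i zi|y [y1 yc]]; first exact: (cP i).1.
  move: Bz; rewrite -FB => /(_ (nth set0 F i)).
  by rewrite (cP i).2 => /(_ _ zi); apply; rewrite -(cP i).2 /= mem_nth.
split; last by rewrite unit_ballE.
suff By : B y by exists B.
rewrite -FB => E /= EF.
have EF' : (index E F < size F)%N by rewrite index_mem.
have := cP (Ordinal EF'); rewrite /= nth_index // => -[_ ->]; exact: yc.
Qed.

Lemma b_open_compl_closed_ball {R : realType} {X : normedModType R} (x : X) (r : R) :
  0 < r -> b_open_in_ball (~` closed_ball_ normr x r `&` unit_ball X).
Proof.
move=> r0; exists (~` closed_ball_ normr x r) => //.
set B := ~` _; exists [set B]; last by rewrite bigcup_set1.
move=> _ ->; exists [fset B]%fset; last by rewrite set_fset1 bigcap_set1.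
by move=> E /fset1P ->; apply/mem_set; exists (x, r).
Qed.

(** * The characterisation *)

Lemma norm_additive_weakly_open {R : realType} {X : normedModType R} (W : set X) :
  daugavet_property X -> (exists x : X, x != 0) ->
  weakly_open_in_ball W -> W !=set0 -> norm_additive W.
Proof.
move=> dX X0 Wo [x Wx]; have [s [e [e0 sW]]] := weakly_open_in_ball_nbhs Wo Wx.
apply: norm_additiveS sW _.
apply: norm_additive_semi_inner_nbhs => //; first exact: dual_form_semi_inner.
by case: Wo Wx => U _ -> [_]; rewrite unit_ballE.
Qed.

Lemma norm_additive_closed_balls {R : realType} {X : normedModType R} (C : set X)
    (n : nat) (x : 'I_n -> X) (r : 'I_n -> R) :
  norm_additive C ->
  C `<=` \bigcup_(i in [set: 'I_n]) closed_ball_ normr (x i) (r i) ->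
  exists i, 1 + `|x i| <= r i.
Proof.
move=> Cn Csub; apply: contrapT => /forallNP nr.
have {}nr i : r i < 1 + `|x i| by rewrite ltNge; apply/negP; exact: nr.
have px i : 0 < 1 + `|x i| by rewrite ltr_pwDl.
(* Half of the smallest relative gap, so that [(1 - eps) * (1 + |x i|)] still exceeds [r i] for
   every [i]. *)
pose eps := \big[Num.min/1]_(i < n) ((1 + `|x i| - r i) / (2 * (1 + `|x i|))).
have eps0 : 0 < eps.
  apply: lt_bigmin => // i _.
  by rewrite divr_gt0 ?subr_gt0 // mulr_gt0.
have [y Cy hy] := Cn [seq - x i | i : 'I_n] _ eps0.
have [i _] := Csub _ Cy; rewrite /closed_ball_ /= leNgt => /negP; apply.
have := hy (- x i) (codom_f (fun i => - x i) i).
rewrite -(opprB y) !normrN [y - _]addrC; apply: lt_le_trans.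
have : eps <= (1 + `|x i| - r i) / (2 * (1 + `|x i|)) by exact: bigmin_le_cond.
rewrite ler_pdivlMr ?mulr_gt0 //; have := nr i; lra.
Qed.

Lemma unit_ball_sub_closed_ball {R : realType} {X : normedModType R} (x : X) (r : R) :
  1 + `|x| <= r -> unit_ball X `<=` closed_ball_ normr x r.
Proof.
move=> xr y; rewrite unit_ballE => y1; apply: le_trans xr.
by rewrite (le_trans (ler_normB _ _)) // addrC lerD2r.
Qed.

(** The coefficient of [T z] along [e] is unique, hence linear in [z], and [|f z| * |e| = |T z|]
    makes it continuous. *)
Lemma rank_oneE {R : realType} {X : normedModType R} (T : {linear X -> X}) :
  bounded_operator T -> rank_one T ->
  exists2 e : X, e != 0 & exists2 f : {linear X -> R^o}, continuous f &
    forall z, T z = (f z : R) *: e.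
Proof.
move=> Tb [e e0 Te]; exists e => //.
have Tspan z : exists a : R, T z = a *: e.
  have [a _ <-] : [set a *: e | a in [set: R]] (T z) by rewrite -Te; exists z.
  by exists a.
have [f fE] := choice Tspan.
have flin : linear (f : X -> R^o).
  move=> a u v; apply/eqP; rewrite -subr_eq0.
  have : (f (a *: u + v) - (a * f u + f v)) *: e == 0.
    by rewrite scalerBl scalerDl -scalerA -!fE linearP subrr.
  by rewrite scaler_eq0 (negbTE e0) orbF.
pose g : {linear X -> R^o} := HB.pack (f : X -> R^o)
  (GRing.isLinear.Build R X R^o *:%R f flin).
exists g => //.
have ne : 0 < `|e| by rewrite normr_gt0.
apply/linear_bounded_continuous/linear_boundedP.
exists (op_norm T / `|e|); split; first exact: num_real.
move=> r rT z; have : `|f z| * `|e| <= op_norm T * `|z|.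
  by rewrite -normrZ -fE linear_op_norm_le.
rewrite -ler_pdivlMr // => /le_trans; apply.
by rewrite mulrAC ler_wpM2r // ltW.
Qed.

Lemma op_norm_addr_ge {R : realType} {X : normedModType R} (T : {linear X -> X})
    (e : X) (f : {linear X -> R^o}) (eps : R) :
  (forall O W : set X, b_open_in_ball O -> O !=set0 ->
      weakly_open_in_ball W -> W !=set0 -> W `&` O !=set0) ->
  bounded_operator T -> e != 0 -> continuous f ->
  (forall z, T z = (f z : R) *: e) -> 0 < eps < 1 ->
  exists2 z, `|z| <= 1 & 1 + op_norm T - 2 * eps <= `|T z + z|.
Proof.
move=> WO Tb e0 fc TE /andP[eps0 eps1]; set c := op_norm T.
have ne : 0 < `|e| by rewrite normr_gt0.
have c0 : 0 <= c.
  by apply: le_trans (op_norm_ge Tb (_ : `|0| <= 1)); rewrite ?normr0.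
pose x := - (c / `|e|) *: e.
have nx : `|x| = c.
  by rewrite normrZ normrN ger0_norm ?divr_ge0 // divfK // gt_eqF.
have [z [[z1 fz] [xz _]]] : slice f ((c - eps) / `|e|) `&`
    (~` closed_ball_ normr x (1 + c - eps) `&` unit_ball X) !=set0.
  apply: WO.
  - by apply: b_open_compl_closed_ball; lra.
  (* The normalised [e] is at distance [1 + c] from [x], hence outside the ball. *)
  - exists (`|e|^-1 *: e); split; last first.
      by rewrite unit_ballE normrZ normfV normr_id mulVf // gt_eqF.
    rewrite /closed_ball_ /= -scalerBl normrZ -opprD normrN.
    rewrite -{2}[_^-1]mul1r -mulrDl ger0_norm ?divr_ge0 ?addr_ge0 //.
    by rewrite divfK ?gt_eqF //; lra.
  - exact: weakly_open_slice.
  - have [y y1] := op_norm_adherent Tb eps0; rewrite -/c TE normrZ => yc.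
    have [fy|fy] := leP 0 (f y : R).
      by exists y; split=> //; rewrite ltr_pdivrMr // -(ger0_norm fy).
    exists (- y); split; first by rewrite normrN.
    by rewrite linearN ltr_pdivrMr // -(ltr0_norm fy).
exists z => //; rewrite TE.
have fze : f z * `|e| <= c.
  apply: le_trans (op_norm_ge Tb z1); rewrite TE normrZ.
  by rewrite ler_wpM2r // ler_norm.
have {xz} : 1 + c - eps < `|x - z| by rewrite ltNge; apply/negP.
(* On the slice [f z *: e] is within [eps] of [- x], so replacing [- x] by [T z] costs a second
   [eps]. *)
have -> : x - z = (f z - c / `|e|) *: e - (f z *: e + z).
  by rewrite scalerBl opprD addrA (addrAC (_ *: e)) subrr add0r -scaleNr.
move=> /lt_le_trans /(_ (ler_normB _ _)).
have : `|((f z : R) - c / `|e|) *: e| <= eps.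
  rewrite normrZ distrC ger0_norm; last first.
    by rewrite subr_ge0 ler_pdivlMr.
  rewrite mulrBl divfK ?gt_eqF //; move: fz; rewrite ltr_pdivrMr //; lra.
lra.
Qed.

Theorem lemma3p1 (R : realType) (X : completeNormedModType R)
    (X_neq0 : exists x : X, x != 0) :
  [<->
    daugavet_property X;
    forall W : set X, weakly_open_in_ball W -> W !=set0 ->
      forall (n : nat) (x : 'I_n -> X) (r : 'I_n -> R),
        (forall i, 0 < r i) ->
        W `<=` \bigcup_(i in [set: 'I_n]) closed_ball_ normr (x i) (r i) ->
        exists i : 'I_n, 1 + `|x i| <= r i /\
          (W `<=` unit_ball X /\
           unit_ball X `<=` closed_ball_ normr (x i) (r i));
    forall O W : set X, b_open_in_ball O -> O !=set0 ->
      weakly_open_in_ball W -> W !=set0 -> W `&` O !=set0 ].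
Proof.
tfae.
- move=> dX W Wo W0 n x r _ Wsub.
  have Wn := norm_additive_weakly_open dX X_neq0 Wo W0.
  have [i ri] := norm_additive_closed_balls Wn Wsub.
  exists i; split=> //; split; last exact: unit_ball_sub_closed_ball.
  by case: Wo => U _ -> y [].
- move=> covering O W Oo [z Oz] Wo W0; apply: contrapT => WO0.
  have [n [x [r [r0 zx sub]]]] := b_open_in_ball_nbhs Oo Oz.
  have z1 : unit_ball X z by case: Oo Oz => U _ -> [].
  have Wball : W `<=` unit_ball X by case: Wo => U _ -> y [].
  (* The ball obtained would contain the whole unit ball, including [z], which avoids every ball. *)
  have [|i [_ [_ /(_ z z1)]]] := covering W Wo W0 n x r r0; last exact: zx.
  move=> y Wy; apply: contrapT => nball; apply: WO0; exists y; split=> //.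
  apply: sub; split; first by rewrite -unit_ballE; exact: Wball.
  by move=> i yi; apply: nball; exists i.
- move=> WO T Tb T1; have [e e0 [f fc TE]] := rank_oneE Tb T1.
  have TIle x : `|x| <= 1 -> `|T x + x| <= 1 + op_norm T.
    move=> x1; rewrite (le_trans (ler_normD _ _)) // addrC lerD //.
    exact: op_norm_ge.
  apply: le_anti; rewrite op_norm_le //=; apply/ler_addgt0Pr => eps eps0.
  (* The estimate loses [2 * d]; the bound by one half keeps [d < 1]. *)
  pose d := Num.min (eps / 2) (2^-1).
  have d01 : 0 < d < 1.
    rewrite lt_min divr_gt0 // invr_gt0 ltr0n /= (@le_lt_trans _ _ 2^-1) //.
      by rewrite ge_min lexx orbT.
    by rewrite invf_lt1 // ltr1n.
  have deps : 2 * d <= eps by rewrite -ler_pdivlMl // mulrC ge_min lexx.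
  have [z z1 zT] := op_norm_addr_ge WO Tb e0 fc TE d01.
  have := op_norm_ge (bounded_operatorP TIle) z1; lra.
Qed.
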